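(* Let $\Lambda$ be a basic finite-dimensional algebra of finite global dimension over an algebraically closed field $\mathbb{k}$, and suppose that $\Lambda=\mathbb{k}Q/I$ is a quadratic monomial algebra. If $\Lambda$ violates the clock condition, then $\Lambda$ admits a non-gradable and relatively projective differential module.
   Context: Modules are finitely generated right modules; $\mathsf{mod}\,\Lambda$ is their category and $\mathsf{proj}\,\Lambda$ the subcategory of projectives. Write $\Lambda=\mathbb{k}Q/I$ with $Q$ a quiver and $I$ an admissible ideal. $\Lambda$ is monomial if $I$ is generated by paths, and a monomial algebra is quadratic if $I$ is generated by paths of length $2$; the relations are then the paths of length $2$ lying in $I$. Clock condition: a monomial algebra satisfies the clock condition if in each cycle of $Q$ (a cycle of the underlying graph, not necessarily oriented) the number of clockwise oriented relations equals the number of counter-clockwise oriented ones (relations being counted along the cycle). Differential modules: a differential module over $\Lambda$ is a pair $(M,\varepsilon_M)$ with $M\in\mathsf{mod}\,\Lambda$ (the underlying module) and $\varepsilon_M\in\mathrm{End}_\Lambda(M)$ satisfying $\varepsilon_M^2=0$. A morphism $(M,\varepsilon_M)\to(N,\varepsilon_N)$ is a $\Lambda$-linear map $f\colon M\to N$ with $f\varepsilon_M=\varepsilon_Nf$. It is relatively projective if $M\in\mathsf{proj}\,\Lambda$. It is gradable if it is isomorphic, as a differential module, to $(\bigoplus_iX^i,\bigoplus_i d^i)$ for some bounded complex $(X^i,d^i)$ over $\mathsf{mod}\,\Lambda$ (i.e. it lies in the essential image of the forgetful functor from bounded complexes to differential modules); otherwise it is non-gradable. *)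

(* Defs.v *)
From HB Require Import structures.
From mathcomp Require Import all_boot all_order all_algebra all_field.
From mathcomp Require Import boolp classical_sets.

Set Implicit Arguments.
Unset Strict Implicit.
Unset Printing Implicit Defensive.

Import Order.TTheory GRing.Theory Num.Theory.
Local Open Scope ring_scope.

Section DirectSum.
Variables (R : pzRingType) (I : choiceType) (X : I -> lmodType R).

Definition finite_support (f : forall i, X i) : Prop :=
  exists s : seq I, forall i, i \notin s -> f i = 0.

Record dsum := DSum {
  dsum_val :> forall i, X i;
  dsum_valP : `[< finite_support dsum_val >]
}.

HB.instance Definition _ := [isSub for dsum_val].
HB.instance Definition _ := [Choice of dsum by <:].

Lemma dsum_supp (x : dsum) : finite_support x.
Proof. exact/asboolP/dsum_valP. Qed.

Lemma dsumP (x y : dsum) : (forall i, x i = y i) -> x = y.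
Proof. by move=> e; apply: val_inj; apply: functional_extensionality_dep. Qed.

Definition mk_dsum f (s : seq I) (fs : forall i, i \notin s -> f i = 0) : dsum :=
  @DSum f (asboolT (ex_intro _ s fs)).

Lemma dsum_sub0 : finite_support (fun=> 0).
Proof. by exists [::]. Qed.
Definition dsum0 : dsum := DSum (asboolT dsum_sub0).

Lemma dsum_subN (x : dsum) : finite_support (fun i => - x i).
Proof. by case: (dsum_supp x) => s xs; exists s => i /xs ->; rewrite oppr0. Qed.
Definition dsum_opp x : dsum := DSum (asboolT (dsum_subN x)).

Lemma dsum_subD (x y : dsum) : finite_support (fun i => x i + y i).
Proof.
case: (dsum_supp x) (dsum_supp y) => s xs [t yt]; exists (s ++ t) => i.
by rewrite mem_cat negb_or => /andP[/xs -> /yt ->]; rewrite addr0.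
Qed.
Definition dsum_add x y : dsum := DSum (asboolT (dsum_subD x y)).

Lemma dsum_subZ (c : R) (x : dsum) : finite_support (fun i => c *: x i).
Proof. by case: (dsum_supp x) => s xs; exists s => i /xs ->; rewrite scaler0. Qed.
Definition dsum_scale c x : dsum := DSum (asboolT (dsum_subZ c x)).

Lemma dsum_addA : associative dsum_add.
Proof. by move=> x y z; apply: dsumP => i /=; rewrite addrA. Qed.
Lemma dsum_addC : commutative dsum_add.
Proof. by move=> x y; apply: dsumP => i /=; rewrite addrC. Qed.
Lemma dsum_add0 : left_id dsum0 dsum_add.
Proof. by move=> x; apply: dsumP => i /=; rewrite add0r. Qed.
Lemma dsum_addN : left_inverse dsum0 dsum_opp dsum_add.
Proof. by move=> x; apply: dsumP => i /=; rewrite addNr. Qed.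

HB.instance Definition _ := GRing.isZmodule.Build dsum
  dsum_addA dsum_addC dsum_add0 dsum_addN.

Lemma dsum_scaleA (a b : R) (x : dsum) :
  dsum_scale a (dsum_scale b x) = dsum_scale (a * b) x.
Proof. by apply: dsumP => i /=; rewrite scalerA. Qed.
Lemma dsum_scale1 : left_id 1 dsum_scale.
Proof. by move=> x; apply: dsumP => i /=; rewrite scale1r. Qed.
Lemma dsum_scaleDr : right_distributive dsum_scale +%R.
Proof. by move=> c x y; apply: dsumP => i /=; rewrite scalerDr. Qed.
Lemma dsum_scaleDl (x : dsum) : {morph dsum_scale^~ x : a b / a + b}.
Proof. by move=> a b; apply: dsumP => i /=; rewrite scalerDl. Qed.

HB.instance Definition _ := GRing.Zmodule_isLmodule.Build R dsum
  dsum_scaleA dsum_scale1 dsum_scaleDr dsum_scaleDl.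

Lemma dsumDE (x y : dsum) i : (x + y) i = x i + y i. Proof. by []. Qed.
Lemma dsumZE (c : R) (x : dsum) i : (c *: x) i = c *: x i. Proof. by []. Qed.
Lemma dsum0E i : (0 : dsum) i = 0. Proof. by []. Qed.


Lemma dsum_sumE (J : Type) (s : seq J) (F : J -> dsum) i :
  (\sum_(j <- s) F j) i = \sum_(j <- s) F j i.
Proof. exact: (big_morph (fun x : dsum => x i) (fun x y => dsumDE x y i) (dsum0E i)). Qed.

Lemma dsum_inj_supp i (y : X i) j : j \notin [:: i] -> dfwith (T := X) (fun=> 0) y j = 0.
Proof. by rewrite inE eq_sym => ij; exact: dfwith_out. Qed.
Definition dsum_inj i (y : X i) : dsum := mk_dsum (@dsum_inj_supp i y).

Lemma dsum_injE i (y : X i) : dsum_inj y i = y.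
Proof. exact: dfwith_in. Qed.

Lemma dsum_inj0 i (y : X i) j : i != j -> dsum_inj y j = 0.
Proof. exact: dfwith_out. Qed.

Lemma dsum_injP i (c : R) (y z : X i) :
  dsum_inj (c *: y + z) = c *: dsum_inj y + dsum_inj z.
Proof.
apply: dsumP => j; rewrite dsumDE dsumZE.
have [e|ne] := eqVneq i j; last by rewrite !dsum_inj0 // scaler0 addr0.
by case: j / e; rewrite !dsum_injE.
Qed.

HB.instance Definition _ i :=
  GRing.isLinear.Build R (X i) dsum *:%R (@dsum_inj i) (@dsum_injP i).

End DirectSum.

(* Modules over R are MathComp's left modules; right modules over an algebra L
   are the left modules over the converse ring L^c. *)
Section Modules.
Variable R : pzRingType.
Implicit Types M N P : lmodType R.

Definition surjective M N (f : M -> N) : Prop := forall y, exists x, f x = y.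

Definition zero_module M : Prop := forall x : M, x = 0.

Definition finitely_generated M : Prop :=
  exists (n : nat) (g : 'I_n -> M),
    forall x, exists c : 'I_n -> R, x = \sum_i c i *: g i.

Definition projective P : Prop :=
  forall (M N : lmodType R) (g : {linear M -> N}) (h : {linear P -> N}),
    surjective g -> exists l : {linear P -> M}, forall x, g (l x) = h x.

Definition isomorphic M N : Prop := exists f : {linear M -> N}, bijective f.

Definition indecomposable M : Prop :=
  ~ zero_module M /\
  forall A B : lmodType R, isomorphic M (A * B)%type ->
    zero_module A \/ zero_module B.

(* A projective resolution of M of length at most n by finitely generated
   modules. *)
Definition proj_dim_le (n : nat) M : Prop :=
  exists (P : nat -> lmodType R) (d : forall i, {linear P i.+1 -> P i})
         (e : {linear P 0%N -> M}),
    [/\ forall i, finitely_generated (P i) /\ projective (P i),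
        forall i, (n < i)%N -> zero_module (P i),
        surjective e,
        forall x, e x = 0 <-> exists y, d 0%N y = x
      & forall i x, d i x = 0 <-> exists y, d i.+1 y = x].

Definition finite_global_dimension : Prop :=
  exists n : nat, forall M, finitely_generated M -> proj_dim_le n M.

(* The regular module is a direct sum of pairwise non-isomorphic indecomposable
   modules. *)
Definition basic_ring : Prop :=
  exists (n : nat) (P : 'I_n -> lmodType R),
    [/\ forall i, indecomposable (P i),
        forall i j, isomorphic (P i) (P j) -> i = j
      & isomorphic R^o (dsum P)].

Record diff_module := DiffModule {
  dm_module :> lmodType R;
  dm_d : {linear dm_module -> dm_module};
  dm_fg : finitely_generated dm_module;
  dm_sq : forall x, dm_d (dm_d x) = 0
}.

Definition diff_morphism (D E : diff_module) (f : {linear D -> E}) : Prop :=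
  forall x, f (dm_d D x) = dm_d E (f x).

Definition diff_isomorphic (D E : diff_module) : Prop :=
  exists f : {linear D -> E}, diff_morphism f /\ bijective f.

Definition relatively_projective (D : diff_module) : Prop := projective D.

(* The differential is indexed by its target: cx_d i is d^(i-1). *)
Record bounded_complex := BoundedComplex {
  cx_obj :> int -> lmodType R;
  cx_d : forall i, {linear cx_obj (i - 1) -> cx_obj i};
  cx_fg : forall i, finitely_generated (cx_obj i);
  cx_sq : forall i x, cx_d i (cx_d (i - 1) x) = 0;
  cx_bounded : exists n : nat, forall i, (n < `|i|)%N -> zero_module (cx_obj i)
}.

Section Total.
Variable X : bounded_complex.

Lemma total_d_supp (x : dsum X) :
  exists s : seq int, forall i, i \notin s -> cx_d X i (x (i - 1)) = 0.
Proof.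
have [s xs] := dsum_supp x; exists [seq i + 1 | i <- s] => i is_.
rewrite xs ?linear0 //; apply: contra is_ => si.
by apply/mapP; exists (i - 1); rewrite // subrK.
Qed.

Definition total_d (x : dsum X) : dsum X := DSum (asboolT (total_d_supp x)).

Lemma total_d_linear : linear total_d.
Proof. by move=> c x y; apply: dsumP => i /=; rewrite linearP. Qed.

HB.instance Definition _ :=
  GRing.isLinear.Build R (dsum X) (dsum X) *:%R total_d total_d_linear.

Lemma total_sq x : total_d (total_d x) = 0.
Proof. by apply: dsumP => i /=; rewrite cx_sq. Qed.

Lemma total_fg : finitely_generated (dsum X).
Proof.
have [n Xn] := cx_bounded X.
pose s : seq int := [seq i%:Z | i <- iota 0 n.+1] ++ [seq - i%:Z | i <- iota 0 n.+1].
have sP (x : dsum X) i : i \notin s -> x i = 0.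
  move=> si; apply: Xn; rewrite ltnNge; apply: contra si => le_in.
  rewrite mem_cat; have [ge0|/ltW le0] := lerP 0 i.
    by apply/orP; left; apply/mapP; exists `|i|%N;
       rewrite ?mem_iota ?ltnS // gez0_abs.
  apply/orP; right; apply/mapP; exists `|i|%N; rewrite ?mem_iota ?ltnS //.
  by rewrite lez0_abs ?opprK.
suff [m [g gP]] : exists m (g : 'I_m -> dsum X), forall x : dsum X,
    (forall i, i \notin s -> x i = 0) -> exists c : 'I_m -> R, x = \sum_i c i *: g i.
  by exists m, g => x; apply: gP; apply: sP.
elim: s {sP} => [|i s [m [g gP]]].
  exists 0%N, (fun=> 0) => x x0; exists (fun=> 0); rewrite big_ord0.
  by apply: dsumP => i; rewrite x0.
have [p [h hP]] := cx_fg X i.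
exists (p + m)%N, (fun j => match split j with inl a => dsum_inj (h a) | inr b => g b end).
move=> x xP; have [c cP] := hP (x i).
have [|b bP] := gP (x - dsum_inj (x i)).
  move=> j js; have [<-|ne] := eqVneq i j.
    by rewrite -[LHS]/(x i - dsum_inj (x i) i) dsum_injE subrr.
  rewrite -[LHS]/(x j - dsum_inj (x i) j) dsum_inj0 // subr0 xP //.
  by rewrite inE negb_or eq_sym ne.
exists (fun j => match split j with inl a => c a | inr b' => b b' end).
rewrite big_split_ord /=; under eq_bigr => a _ do rewrite (unsplitK (inl a)).
under [X in _ + X]eq_bigr => a _ do rewrite (unsplitK (inr a)).
rewrite -bP -[LHS](subrK (dsum_inj (x i))) addrC; congr (_ + _).
rewrite {1}cP linear_sum; apply: eq_bigr => a _; exact: linearZ.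
Qed.

(* The differential module (\bigoplus_i X^i, \bigoplus_i d^i). *)
Definition total_diff : diff_module := @DiffModule (dsum X) total_d total_fg total_sq.

End Total.

Definition gradable (D : diff_module) : Prop :=
  exists X : bounded_complex, diff_isomorphic D (total_diff X).

End Modules.

Record quiver := Quiver {
  vertex : finType;
  arrow : finType;
  src : arrow -> vertex;
  tgt : arrow -> vertex
}.

Section Paths.
Variable Q : quiver.

Fixpoint walk (v : vertex Q) (s : seq (arrow Q)) : bool :=
  if s is a :: s' then (src a == v) && walk (tgt a) s' else true.

Definition walk_end (v : vertex Q) (s : seq (arrow Q)) := last v (map (@tgt Q) s).

(* A path is a start vertex together with composable arrows, listed in the
   order in which they are traversed; the empty list gives the trivial path. *)
Record qpath := QPath {
  path_val : vertex Q * seq (arrow Q);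
  path_valP : walk path_val.1 path_val.2
}.

HB.instance Definition _ := [isSub for path_val].
HB.instance Definition _ := [Choice of qpath by <:].

Definition path_src (p : qpath) := (path_val p).1.
Definition path_arrows (p : qpath) := (path_val p).2.
Definition path_tgt (p : qpath) := walk_end (path_src p) (path_arrows p).
Definition path_length (p : qpath) := size (path_arrows p).

Definition trivial_path (v : vertex Q) : qpath := @QPath (v, [::]) isT.

Lemma walk1 (a : arrow Q) : walk (src a) [:: a].
Proof. by rewrite /= eqxx. Qed.

Definition arrow_path (a : arrow Q) : qpath := @QPath (src a, [:: a]) (walk1 a).

(* "First p, then q"; None when p does not end where q starts. *)
Definition path_comp (p q : qpath) : option qpath :=
  if path_tgt p == path_src q
  then insub (path_src p, path_arrows p ++ path_arrows q) else None.

Lemma walk_cat v s1 s2 :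
  walk v (s1 ++ s2) = walk v s1 && walk (walk_end v s1) s2.
Proof. by elim: s1 v => //= a s1 IH v; rewrite IH andbA. Qed.

Lemma walk_end_cat v s1 s2 :
  walk_end v (s1 ++ s2) = walk_end (walk_end v s1) s2.
Proof. by rewrite /walk_end map_cat last_cat. Qed.

Variant path_comp_spec (p q : qpath) : option qpath -> Prop :=
| PathComp r of path_tgt p = path_src q & path_src r = path_src p
    & path_arrows r = path_arrows p ++ path_arrows q :
    path_comp_spec p q (Some r)
| PathNoComp of path_tgt p != path_src q : path_comp_spec p q None.

Lemma path_compP p q : path_comp_spec p q (path_comp p q).
Proof.
rewrite /path_comp; case: eqP => [e|/eqP]; last by constructor.
case: insubP => [r _ er|].
  by constructor; rewrite // /path_src /path_arrows -[path_val r]/(val r) er.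
by rewrite /= walk_cat (path_valP p) -/(path_tgt p) e (path_valP q).
Qed.

Lemma path_eq (p q : qpath) :
  path_src p = path_src q -> path_arrows p = path_arrows q -> p = q.
Proof.
move=> e1 e2; apply: val_inj; move: e1 e2; rewrite /path_src /path_arrows /=.
by case: (path_val p) (path_val q) => [? ?] [? ?] /= -> ->.
Qed.

Lemma path_tgt_comp p q r : path_tgt p = path_src q ->
  path_src r = path_src p -> path_arrows r = path_arrows p ++ path_arrows q ->
  path_tgt r = path_tgt q.
Proof. by rewrite /path_tgt => e -> ->; rewrite walk_end_cat e. Qed.

Lemma path_compA p q r :
  obind (path_comp^~ r) (path_comp p q) = obind (path_comp p) (path_comp q r).
Proof.
case: path_compP => [pq e1 s1 a1|n1]; case: path_compP => [qr e2 s2 a2|n2] //=.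
- case: path_compP => [l e3 s3 a3|].
    case: path_compP => [m e4 s4 a4|]; last by rewrite s2 e1 eqxx.
    congr Some; apply: path_eq; first by rewrite s3 s1 s4.
    by rewrite a3 a1 a4 a2 catA.
  by rewrite (path_tgt_comp e1 s1 a1) e2 eqxx.
- by case: path_compP => // l; rewrite (path_tgt_comp e1 s1 a1) => e; rewrite e eqxx in n2.
- by case: path_compP => // l; rewrite s2 => e; rewrite e eqxx in n1.
Qed.

Lemma path_comp1l v p :
  path_comp (trivial_path v) p = if v == path_src p then Some p else None.
Proof.
case: path_compP => [r e sr ar|/negbTE n]; last by rewrite (n : v == _ = _).
have {}e : v = path_src p := e.
by rewrite e eqxx; congr Some; apply: path_eq; rewrite ?sr ?ar.
Qed.

Lemma path_comp1r v p :
  path_comp p (trivial_path v) = if path_tgt p == v then Some p else None.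
Proof.
case: path_compP => [r e sr ar|/negbTE n]; last by rewrite (n : _ == v = _).
have {}e : path_tgt p = v := e.
by rewrite e eqxx; congr Some; apply: path_eq; rewrite ?sr ?ar //= cats0.
Qed.

End Paths.

Section PathVect.
Variables (k : fieldType) (Q : quiver).

(* The path algebra as a vector space: finitely supported functions on the set
   of paths. *)
Record path_algebra := PathAlgebra {
  path_coef : qpath Q -> k;
  path_coefP : `[< exists s : seq (qpath Q), forall p, p \notin s -> path_coef p = 0 >]
}.

HB.instance Definition _ := [isSub for path_coef].
HB.instance Definition _ := [Choice of path_algebra by <:].

Lemma path_algebraP (x y : path_algebra) : path_coef x =1 path_coef y -> x = y.
Proof. by move=> e; apply: val_inj; apply: functional_extensionality_dep. Qed.

Lemma path_supp (x : path_algebra) :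
  exists s : seq (qpath Q), forall p, p \notin s -> path_coef x p = 0.
Proof. exact/asboolP/path_coefP. Qed.

Definition mk_path f (s : seq (qpath Q)) (fs : forall p, p \notin s -> f p = 0) :
  path_algebra := @PathAlgebra f (asboolT (ex_intro _ s fs)).

Definition path_zero : path_algebra := @mk_path (fun=> 0) [::] (fun _ _ => erefl).

Lemma path_opp_supp (x : path_algebra) :
  exists s : seq (qpath Q), forall p, p \notin s -> - path_coef x p = 0.
Proof. by case: (path_supp x) => s xs; exists s => p /xs ->; rewrite oppr0. Qed.
Definition path_opp x := PathAlgebra (asboolT (path_opp_supp x)).

Lemma path_add_supp (x y : path_algebra) :
  exists s : seq (qpath Q), forall p, p \notin s -> path_coef x p + path_coef y p = 0.
Proof.
case: (path_supp x) (path_supp y) => s xs [t yt]; exists (s ++ t) => p.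
by rewrite mem_cat negb_or => /andP[/xs -> /yt ->]; rewrite addr0.
Qed.
Definition path_add x y := PathAlgebra (asboolT (path_add_supp x y)).

Lemma path_scale_supp (c : k) (x : path_algebra) :
  exists s : seq (qpath Q), forall p, p \notin s -> c * path_coef x p = 0.
Proof. by case: (path_supp x) => s xs; exists s => p /xs ->; rewrite mulr0. Qed.
Definition path_scale c x := PathAlgebra (asboolT (path_scale_supp c x)).

Lemma path_addA : associative path_add.
Proof. by move=> x y z; apply: path_algebraP => p /=; rewrite addrA. Qed.
Lemma path_addC : commutative path_add.
Proof. by move=> x y; apply: path_algebraP => p /=; rewrite addrC. Qed.
Lemma path_add0 : left_id path_zero path_add.
Proof. by move=> x; apply: path_algebraP => p /=; rewrite add0r. Qed.
Lemma path_addN : left_inverse path_zero path_opp path_add.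
Proof. by move=> x; apply: path_algebraP => p /=; rewrite addNr. Qed.

HB.instance Definition _ := GRing.isZmodule.Build path_algebra
  path_addA path_addC path_add0 path_addN.

Lemma path_scaleA (a b : k) (x : path_algebra) :
  path_scale a (path_scale b x) = path_scale (a * b) x.
Proof. by apply: path_algebraP => p /=; rewrite mulrA. Qed.
Lemma path_scale1 : left_id 1 path_scale.
Proof. by move=> x; apply: path_algebraP => p /=; rewrite mul1r. Qed.
Lemma path_scaleDr : right_distributive path_scale +%R.
Proof. by move=> c x y; apply: path_algebraP => p /=; rewrite mulrDr. Qed.
Lemma path_scaleDl (x : path_algebra) : {morph path_scale^~ x : a b / a + b}.
Proof. by move=> a b; apply: path_algebraP => p /=; rewrite mulrDl. Qed.

HB.instance Definition _ := GRing.Zmodule_isLmodule.Build k path_algebra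
  path_scaleA path_scale1 path_scaleDr path_scaleDl.

Lemma path_elt_supp (p q : qpath Q) : q \notin [:: p] -> (p == q)%:R = 0 :> k.
Proof. by rewrite inE eq_sym => /negbTE ->. Qed.

End PathVect.

HB.lock Definition path_elt (k : fieldType) (Q : quiver) (p : qpath Q) :
  path_algebra k Q := mk_path (@path_elt_supp k Q p).

(* Linear extension of a function defined on paths; the sum is over some finite
   set of paths containing the support of x. *)
HB.lock Definition path_ext (k : fieldType) (Q : quiver) (M : lmodType k)
    (f : qpath Q -> M) (x : path_algebra k Q) : M :=
  \sum_(p <- undup (sval (cid (path_supp x)))) path_coef x p *: f p.

Lemma eq_lincomb (k : fieldType) (K : eqType) (M : lmodType k) (c : K -> k)
    (f : K -> M) (s t : seq K) : uniq s -> uniq t ->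
  (forall p, p \notin s -> c p = 0) -> (forall p, p \notin t -> c p = 0) ->
  \sum_(p <- s) c p *: f p = \sum_(p <- t) c p *: f p.
Proof.
move=> us ut cs ct; pose P p := c p == 0.
have z (r : seq K) : \sum_(p <- r) c p *: f p = \sum_(p <- r | ~~ P p) c p *: f p.
  rewrite (bigID P) /= [X in X + _]big1 ?add0r // => p /eqP ->.
  exact: scale0r.
rewrite z [RHS]z -big_filter -[RHS]big_filter.
apply: perm_big; apply: uniq_perm; [exact: filter_uniq|exact: filter_uniq|].
move=> p; rewrite !mem_filter; case: (boolP (P p)) => //= nP.
have -> : p \in s by apply/negPn/negP => /cs/eqP; apply/negP.
by apply/esym/negPn/negP => /ct/eqP; apply/negP.
Qed.

Section PathAlgebra.
Variables (k : fieldType) (Q : quiver).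
Local Notation kQ := (path_algebra k Q).

Lemma path_eltE (p q : qpath Q) : path_coef (path_elt k p) q = (p == q)%:R.
Proof. by rewrite path_elt.unlock. Qed.

Lemma path_addE (x y : kQ) p : path_coef (x + y) p = path_coef x p + path_coef y p.
Proof. by []. Qed.

Lemma path_scaleE (c : k) (x : kQ) p : path_coef (c *: x) p = c * path_coef x p.
Proof. by []. Qed.

Lemma path_sumE (I : Type) (s : seq I) (F : I -> kQ) p :
  path_coef (\sum_(i <- s) F i) p = \sum_(i <- s) path_coef (F i) p.
Proof.
exact: (big_morph (fun x : kQ => path_coef x p) (fun x y => path_addE x y p)).
Qed.

Lemma path_algebraE (x : kQ) (s : seq (qpath Q)) : uniq s ->
  (forall p, p \notin s -> path_coef x p = 0) -> x = \sum_(p <- s) path_coef x p *: path_elt k p.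
Proof.
move=> us xs; apply: path_algebraP => q; rewrite path_sumE.
under eq_bigr do rewrite path_scaleE path_eltE.
have [qs|/[dup] qs /xs ->] := boolP (q \in s).
  rewrite (bigD1_seq q) //= eqxx big1 => [|p /negbTE ->]; last exact: mulr0.
  by rewrite addr0 mulr1.
rewrite big_seq big1 // => p ps; case: eqP => [e|_]; last exact: mulr0.
by rewrite -e ps in qs.
Qed.

Lemma path_extEw (M : lmodType k) (f : qpath Q -> M) (x : kQ) (s : seq (qpath Q)) :
  uniq s -> (forall p, p \notin s -> path_coef x p = 0) ->
  path_ext f x = \sum_(p <- s) path_coef x p *: f p.
Proof.
move=> us xs; rewrite path_ext.unlock; case: cid => t xt /=.
by apply: eq_lincomb => // [|p]; [exact: undup_uniq|rewrite mem_undup => /xt].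
Qed.

Lemma path_extP (M : lmodType k) (f : qpath Q -> M) (c : k) (x y : kQ) :
  path_ext f (c *: x + y) = c *: path_ext f x + path_ext f y.
Proof.
have [s xs] := path_supp x; have [t yt] := path_supp y.
have us : uniq (undup (s ++ t)) by exact: undup_uniq.
have H p : p \notin undup (s ++ t) -> path_coef x p = 0 /\ path_coef y p = 0.
  by rewrite mem_undup mem_cat negb_or => /andP[/xs ? /yt ?].
rewrite (path_extEw f us (fun p np => (H p np).1)).
rewrite (path_extEw f us (fun p np => (H p np).2)).
rewrite (@path_extEw M f (c *: x + y) _ us) => [|p /H[xp yp]]; last first.
  by rewrite path_addE path_scaleE xp yp mulr0 addr0.
rewrite scaler_sumr -big_split /=; apply: eq_bigr => p _.
by rewrite scalerDl scalerA.
Qed.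

Lemma path_ext_linear (M : lmodType k) (f : qpath Q -> M) : linear (@path_ext k Q M f).
Proof. exact: path_extP. Qed.

HB.instance Definition _ (M : lmodType k) (f : qpath Q -> M) :=
  GRing.isLinear.Build k kQ M *:%R (@path_ext k Q M f) (path_ext_linear f).

Lemma path_ext_elt (M : lmodType k) (f : qpath Q -> M) p :
  path_ext f (path_elt k p) = f p.
Proof.
rewrite (@path_extEw _ _ _ [:: p]) // => [|q].
  by rewrite big_seq1 path_eltE eqxx scale1r.
by rewrite path_eltE inE eq_sym => /negbTE ->.
Qed.

Lemma path_algebra_ind (P : kQ -> Prop) :
  (forall p, P (path_elt k p)) -> P 0 ->
  (forall c x y, P x -> P y -> P (c *: x + y)) -> forall x, P x.
Proof.
move=> Pe P0 PD x; have [s xs] := path_supp x.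
rewrite (@path_algebraE x (undup s)) ?undup_uniq // => [|p].
  by elim/big_rec: _ => // p y _ Py; apply: PD.
by rewrite mem_undup => /xs.
Qed.

Definition path_elt_mul (p q : qpath Q) : kQ :=
  if path_comp p q is Some r then path_elt k r else 0.

End PathAlgebra.

(* Bilinear extension of the concatenation of paths, a non-composable product
   of paths being 0. *)
HB.lock Definition path_mul (k : fieldType) (Q : quiver) (x y : path_algebra k Q) :
  path_algebra k Q := path_ext (fun p => path_ext (path_elt_mul k p) y) x.

Definition path_one (k : fieldType) (Q : quiver) : path_algebra k Q :=
  \sum_(v : vertex Q) path_elt k (trivial_path v).

Section PathAlgebraRing.
Variables (k : fieldType) (Q : quiver).
Local Notation kQ := (path_algebra k Q).

Lemma path_mul_elt (p q : qpath Q) :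
  path_mul (path_elt k p) (path_elt k q) = path_elt_mul k p q.
Proof. by rewrite path_mul.unlock !path_ext_elt. Qed.

Lemma path_mul_eltr (p : qpath Q) (y : kQ) : path_mul (path_elt k p) y = path_ext (path_elt_mul k p) y.
Proof. by rewrite path_mul.unlock !path_ext_elt. Qed.

Lemma path_mulPl c (x y z : kQ) :
  path_mul (c *: x + y) z = c *: path_mul x z + path_mul y z.
Proof. by rewrite path_mul.unlock linearP. Qed.

Lemma path_mul0l (x : kQ) : path_mul 0 x = 0.
Proof. by rewrite path_mul.unlock linear0. Qed.

Lemma path_mulPr c (x y z : kQ) :
  path_mul x (c *: y + z) = c *: path_mul x y + path_mul x z.
Proof.
elim/path_algebra_ind: x => [p||d x x' IH IH'].
- by rewrite !path_mul_eltr linearP.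
- by rewrite !path_mul0l scaler0 addr0.
- by rewrite !path_mulPl IH IH' !scalerDr !scalerA mulrC addrACA.
Qed.

Lemma path_mul0r (x : kQ) : path_mul x 0 = 0.
Proof.
elim/path_algebra_ind: x => [p||d x x' IH IH']; first by rewrite path_mul_eltr linear0.
- exact: path_mul0l.
- by rewrite path_mulPl IH IH' scaler0 addr0.
Qed.

Lemma path_mulDl : left_distributive (@path_mul k Q) +%R.
Proof. by move=> x y z; have := path_mulPl 1 x y z; rewrite !scale1r. Qed.

Lemma path_mulDr : right_distributive (@path_mul k Q) +%R.
Proof. by move=> x y z; have := path_mulPr 1 x y z; rewrite !scale1r. Qed.

Lemma path_mulA : associative (@path_mul k Q).
Proof.
move=> x y z; elim/path_algebra_ind: x => [p||c x x' IH IH'].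
- elim/path_algebra_ind: y => [q||c y y' IH IH'].
  + elim/path_algebra_ind: z => [r||c z z' IH IH'].
    * have := path_compA p q r; rewrite (path_mul_elt q r) (path_mul_elt p q).
      rewrite /path_elt_mul.
      case: (path_comp p q) => [pq|]; case: (path_comp q r) => [qr|] /= E.
      - by rewrite !path_mul_elt /path_elt_mul E.
      - by rewrite path_mul0r path_mul_elt /path_elt_mul E.
      - by rewrite path_mul0l path_mul_elt /path_elt_mul -E.
      - by rewrite path_mul0l path_mul0r.
    * by rewrite !path_mul0r.
    * by rewrite !path_mulPr IH IH'.
  + by rewrite path_mul0l path_mul0r path_mul0l.
  + by rewrite !(path_mulPr, path_mulPl) IH IH'.
- by rewrite !path_mul0l.
- by rewrite !path_mulPl IH IH'.
Qed.

Lemma path_mul_suml (I : Type) (s : seq I) (F : I -> kQ) y :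
  path_mul (\sum_(i <- s) F i) y = \sum_(i <- s) path_mul (F i) y.
Proof. by elim/big_ind2: _ => [|a b c d <- <-|//]; rewrite ?path_mul0l ?path_mulDl. Qed.

Lemma path_mul_sumr (I : Type) (s : seq I) (F : I -> kQ) x :
  path_mul x (\sum_(i <- s) F i) = \sum_(i <- s) path_mul x (F i).
Proof. by elim/big_ind2: _ => [|a b c d <- <-|//]; rewrite ?path_mul0r ?path_mulDr. Qed.

Lemma path_mul1l : left_id (path_one k Q) (@path_mul k Q).
Proof.
move=> x; elim/path_algebra_ind: x => [p||c x y IH IH'].
- rewrite path_mul_suml (bigD1 (path_src p)) //= big1 => [|v /negbTE nv].
    by rewrite path_mul_elt /path_elt_mul path_comp1l eqxx addr0.
  by rewrite path_mul_elt /path_elt_mul path_comp1l nv.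
- exact: path_mul0r.
- by rewrite path_mulPr IH IH'.
Qed.

Lemma path_mul1r : right_id (path_one k Q) (@path_mul k Q).
Proof.
move=> x; elim/path_algebra_ind: x => [p||c x y IH IH'].
- rewrite path_mul_sumr (bigD1 (path_tgt p)) //= big1 => [|v nv].
    by rewrite path_mul_elt /path_elt_mul path_comp1r eqxx addr0.
  by rewrite path_mul_elt /path_elt_mul path_comp1r eq_sym (negbTE nv).
- exact: path_mul0l.
- by rewrite path_mulPl IH IH'.
Qed.

Lemma path_scaleAl c (x y : kQ) : c *: path_mul x y = path_mul (c *: x) y.
Proof. by have := path_mulPl c x 0 y; rewrite path_mul0l !addr0. Qed.

Lemma path_scaleAr c (x y : kQ) : c *: path_mul x y = path_mul x (c *: y).
Proof. by have := path_mulPr c x y 0; rewrite path_mul0r !addr0. Qed.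

HB.instance Definition _ := GRing.Zmodule_isPzRing.Build kQ
  path_mulA path_mul1l path_mul1r path_mulDl path_mulDr.

End PathAlgebraRing.

Section Ideals.
Local Open Scope classical_set_scope.

Definition two_sided_ideal (A : pzRingType) (I : set A) : Prop :=
  [/\ I 0, forall x y, I x -> I y -> I (x + y)
    & forall a x, I x -> I (a * x) /\ I (x * a)].

Definition ideal_gen (A : pzRingType) (S : set A) : set A :=
  smallest (@two_sided_ideal A) S.

Definition ideal_mul (A : pzRingType) (I J : set A) : set A :=
  ideal_gen [set x * y | x in I & y in J].

Definition ideal_pow (A : pzRingType) (I : set A) (n : nat) : set A :=
  iter n (ideal_mul I) setT.

Variables (k : fieldType) (Q : quiver).
Implicit Type I : set (path_algebra k Q).

Definition arrow_ideal : set (path_algebra k Q) :=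
  ideal_gen (range (fun a : arrow Q => path_elt k (arrow_path a))).

Definition admissible I : Prop :=
  two_sided_ideal I /\
  exists2 m : nat, (2 <= m)%N &
    ideal_pow arrow_ideal m `<=` I /\ I `<=` ideal_pow arrow_ideal 2.

Definition quadratic_monomial I : Prop :=
  exists2 S : set (qpath Q), (forall p, S p -> path_length p = 2%N)
    & I = ideal_gen [set path_elt k p | p in S].

(* A is isomorphic, as a k-algebra, to kQ/I.  (The path algebra of the empty
   quiver is the zero ring, so {lrmorphism _ -> _} is not available here.) *)
Definition quotient_algebra I (A : algType k) : Prop :=
  exists pi : {rmorphism path_algebra k Q -> A},
    [/\ scalable pi, forall y, exists x, pi x = y & forall x, pi x = 0 <-> I x].

Definition is_relation I (a b : arrow Q) : Prop :=
  exists2 p, path_comp (arrow_path a) (arrow_path b) = Some p & I (path_elt k p).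

End Ideals.

Section Clock.
Variables (k : fieldType) (Q : quiver).

(* An arrow traversed forwards (true) or backwards (false). *)
Definition letter := (arrow Q * bool)%type.
Definition letter_src (l : letter) := if l.2 then src l.1 else tgt l.1.
Definition letter_tgt (l : letter) := if l.2 then tgt l.1 else src l.1.

(* Cycle of the underlying multigraph, with a starting point and a direction:
   no repeated vertex and no repeated edge (the latter excludes traversing one
   arrow back and forth).  A loop is a cycle of length 1, two distinct arrows
   between the same two vertices form a cycle of length 2. *)
Definition graph_cycle (w : seq letter) : bool :=
  [&& w != [::], cycle (fun l m => letter_tgt l == letter_src m) w,
      uniq (map letter_src w) & uniq (map fst w)].

(* Pairs of cyclically consecutive letters. *)
Definition turns (w : seq letter) : seq (letter * letter) := zip w (rot 1 w).

Definition clockwise_relations (I : set (path_algebra k Q)) (w : seq letter) : nat :=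
  count (fun lm : letter * letter =>
    [&& lm.1.2, lm.2.2 & `[< is_relation I lm.1.1 lm.2.1 >]]) (turns w).

Definition counterclockwise_relations (I : set (path_algebra k Q)) (w : seq letter) : nat :=
  count (fun lm : letter * letter =>
    [&& ~~ lm.1.2, ~~ lm.2.2 & `[< is_relation I lm.2.1 lm.1.1 >]]) (turns w).

Definition clock_condition (I : set (path_algebra k Q)) : Prop :=
  forall w, graph_cycle w -> clockwise_relations I w = counterclockwise_relations I w.

End Clock.

(* Main.v *)
From HB Require Import structures.
Require Import Defs.
From mathcomp Require Import all_boot all_order all_algebra all_field.
From mathcomp Require Import boolp classical_sets.
From mathcomp Require Import zify.
Set Implicit Arguments.
Unset Strict Implicit.
Unset Printing Implicit Defensive.
Import GRing.Theory.
Local Open Scope ring_scope.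

(* Cut a cycle violating the clock condition at its relations and at its changes
   of orientation. This leaves blocks, each a path p outside I, and the sum x of
   these paths has square zero in L = kQ/I because two blocks compose only
   across a relation. The differential module is the regular module L with
   left multiplication by x as differential.

   If it were gradable, then for every nonzero t in k the grading would give a
   unit u of L with u x = t x u. Since I is spanned by paths, comparing the
   coefficients of a block p yields c (src p) = t c (tgt p), where c v != 0 is
   the coefficient of u at the trivial path at v. Going once around the cycle
   gives t ^ m = t ^ n, where m and n count the forward and backward blocks.
   As m - n is the difference between the numbers of clockwise and
   counter-clockwise relations, m != n, and a suitable t yields a
   contradiction. *)

Lemma path_comp_exists (Q : quiver) (p q : qpath Q) : path_tgt p = path_src q ->
  exists r, [/\ path_comp p q = Some r, path_src r = path_src p,
    path_tgt r = path_tgt q & path_arrows r = path_arrows p ++ path_arrows q].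
Proof.
move=> e; case: path_compP => [r _ r_src r_arr|]; last by rewrite e eqxx.
by exists r; split=> //; exact: path_tgt_comp e r_src r_arr.
Qed.

Section Cutting.
Variables (k : fieldType) (Q : quiver) (I : set (path_algebra k Q)).

Definition follows (s : bool) (a b : arrow Q) : bool :=
  ~~ (if s then `[< is_relation I a b >] else `[< is_relation I b a >]).

Definition smooth (l m : letter Q) : bool :=
  (l.2 == m.2) && follows l.2 l.1 m.1.

(* A path traversed forwards (true) or backwards (false); this coarsens [letter]. *)
Definition block := (qpath Q * bool)%type.
Implicit Types (b c : block) (bs : seq block) (l m : letter Q) (w : seq (letter Q)).

Definition block_src b := if b.2 then path_src b.1 else path_tgt b.1.
Definition block_tgt b := if b.2 then path_tgt b.1 else path_src b.1.
Definition block_arrows b :=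
  if b.2 then path_arrows b.1 else rev (path_arrows b.1).
Definition block_link b c := block_tgt b == block_src c.
Definition smooth_block b :=
  (block_arrows b != [::]) && sorted (follows b.2) (block_arrows b).
Definition block_cut b c :=
  (b.2 == c.2) ==> ~~ sorted (follows b.2) (block_arrows b ++ block_arrows c).

Definition letter_block l : block := (arrow_path l.1, l.2).

Lemma letter_block_tgt l : block_tgt (letter_block l) = letter_tgt l.
Proof. by []. Qed.

Lemma letter_block_arrows l : block_arrows (letter_block l) = [:: l.1].
Proof. by rewrite /block_arrows /=; case: ifP. Qed.

Lemma extend_block l b : l.2 = b.2 -> letter_tgt l = block_src b ->
  exists c, [/\ c.2 = b.2, block_src c = letter_src l, block_tgt c = block_tgt b
             & block_arrows c = l.1 :: block_arrows b].
Proof.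
case: l b => a s [p s2] /= <-{s2}.
rewrite /letter_tgt /letter_src /block_src /block_tgt /block_arrows.
case: s => /= e.
  have [r [_ r_src r_tgt r_arr]] := @path_comp_exists Q (arrow_path a) p e.
  by exists (r, true); rewrite /= r_src r_tgt r_arr.
have [r [_ r_src r_tgt r_arr]] := @path_comp_exists Q p (arrow_path a) (esym e).
by exists (r, false); rewrite /= r_src r_tgt r_arr rev_cat.
Qed.

Lemma block_cut_join b c s a d t : block_arrows b = rcons s a ->
  block_arrows c = d :: t -> ~~ smooth (a, b.2) (d, c.2) -> block_cut b c.
Proof.
rewrite /block_cut /smooth /= => -> -> /nandP ns; apply/implyP => /eqP e.
case: ns => [|nf]; first by rewrite e eqxx.
case: s => [|x s] /=; first by rewrite (negbTE nf).
by rewrite cat_path rcons_path last_rcons /= (negbTE nf) !andbF.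
Qed.

Definition steps l w : seq (letter Q * letter Q) := pairmap pair l w.

Definition cw_turn (lm : letter Q * letter Q) :=
  [&& lm.1.2, lm.2.2 & `[< is_relation I lm.1.1 lm.2.1 >]].
Definition ccw_turn (lm : letter Q * letter Q) :=
  [&& ~~ lm.1.2, ~~ lm.2.2 & `[< is_relation I lm.2.1 lm.1.1 >]].

(* Relations occur only at cuts, so the difference between the numbers of forward
   and backward blocks is that between the two kinds of relations, up to a
   boundary term given by the directions of the first and last letters. *)
Lemma cut_walk l w :
  path (fun l m => letter_tgt l == letter_src m) l w ->
  exists b bs,
  [/\ [/\ block_src b = letter_src l,
          block_tgt (last b bs) = letter_tgt (last l w),
          path block_link b bs,
          subseq (map block_src (b :: bs)) (map (@letter_src Q) (l :: w))
        & flatten (map block_arrows (b :: bs)) = map fst (l :: w)],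
      [/\ all smooth_block (b :: bs), path block_cut b bs,
          b.2 = l.2 & (last b bs).2 = (last l w).2]
    & (count snd (b :: bs) + count ccw_turn (steps l w) + 1 =
       count (fun b => ~~ b.2) (b :: bs) + count cw_turn (steps l w)
         + l.2 + (last l w).2)%N].
Proof.
elim: w l => [|m w IH] l /=.
  move=> _; exists (letter_block l), [::].
  rewrite /= letter_block_arrows /smooth_block letter_block_arrows.
  by split; [split | split | case: l.2]; rewrite //= ?subseq_refl ?eqxx.
case/andP => /eqP elm /IH[b [bs [[src_b tgt_b lk ss fl] [sm ct sb sl] cnt]]].
have [[t bt] [nb sob]] : (exists t, block_arrows b = m.1 :: t) /\
    (block_arrows b != [::] /\ sorted (follows b.2) (block_arrows b)).
  move: sm fl => /= /andP[/andP[+ +] _]; case: (block_arrows b) => //= a t _ ->.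
  by case=> -> _; split=> //; exists t.
case: (boolP (smooth l m)) => [/andP[/eqP s1 s2] | ns].
  have [|c [sc src_c tgt_c arr_c]] := @extend_block l b (etrans s1 (esym sb)).
    by rewrite elm src_b.
  have lastE : forall (T : Type) (f : block -> T), f c = f b ->
     f (last c bs) = f (last b bs) by move=> T f; case: (bs).
  exists c, bs; split.
  - split => //; first by rewrite (lastE _ block_tgt).
    + case: (bs) lk => //= d bs'; by rewrite /block_link tgt_c.
    + rewrite /= src_c eqxx; apply: subseq_trans (subseq_cons _ _).
      by move: ss; rewrite /= src_b eqxx.
    + by rewrite /= arr_c; congr cons; exact: fl.
  - split; last 2 first.
    + by rewrite s1 sc.
    + by rewrite (lastE _ snd).
    + move: sm => /= /andP[_ ->]; rewrite andbT /smooth_block arr_c bt /=.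
      by rewrite sc sb -s1 s2; move: sob; rewrite bt sb s1.
    case: (bs) ct => //= d bs' /andP[H ->]; rewrite andbT.
    move: H; rewrite /block_cut sc arr_c bt /=; case: (_ == _) => //=.
    by apply: contra => /andP[].
  - move: cnt; rewrite /= sc.
    have -> : cw_turn (l, m) = false.
      move: s2; rewrite /follows /cw_turn /=.
      by case: l.2 => //= /negbTE ->; rewrite andbF.
    have -> : ccw_turn (l, m) = false.
      move: s2; rewrite /follows /ccw_turn /=.
      by case: l.2 => //= /negbTE ->; rewrite andbF.
    by rewrite s1 !add0n.
exists (letter_block l), (b :: bs); split.
- split => //=; first by rewrite /block_link letter_block_tgt elm src_b eqxx.
    by rewrite eqxx; exact: ss.
  by rewrite letter_block_arrows; congr cons; exact: fl.
- split => //=.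
    by move: sm => /= ->; rewrite /smooth_block letter_block_arrows.
  rewrite ct andbT; apply: (@block_cut_join _ _ [::] l.1 m.1 t) => //.
    exact: letter_block_arrows.
  by rewrite sb; case: (l) (m) ns => ? ? [].
- move: cnt ns; rewrite /= !sb /smooth /follows /cw_turn /ccw_turn /=.
  by case: l.2; case: m.2 => /= cnt; rewrite ?negbK => rel; try rewrite rel;
     clear -cnt; lia.
Qed.

Lemma path_breakP (T : Type) (e : rel T) x p : ~~ path e x p ->
  exists p1 y p2, p = p1 ++ y :: p2 /\ ~~ e (last x p1) y.
Proof.
elim: p x => //= y p IH x; case: (boolP (e x y)) => /= [_|n _].
  by move=> /IH[p1 [z [p2 [-> n]]]]; exists (y :: p1), z, p2.
by exists [::], y, p.
Qed.

Lemma cycle_breakP (T : Type) (e : rel T) p : ~~ cycle e p ->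
  exists i x q, rot i p = x :: q /\ ~~ e (last x q) x.
Proof.
case: p => [|x p] // not_path; have [p1 [y [p2 []]]] := path_breakP not_path.
elim/last_ind: p2 => [|p2 z _].
  by rewrite cats1 => /rcons_inj[<- <-] n; exists 0%N, x, p; rewrite rot0.
rewrite -rcons_cons -rcons_cat => /rcons_inj[-> _] n.
exists (size (x :: p1)), y, (p2 ++ x :: p1); rewrite -cat_cons rot_size_cat.
by rewrite last_cat.
Qed.

Lemma zip_rot (S T : Type) (s : seq S) (t : seq T) i : size s = size t ->
  zip (rot i s) (rot i t) = rot i (zip s t).
Proof.
move=> st; case: (leqP (size s) i) => [ov|/ltnW le_i].
  by rewrite !rot_oversize ?size_zip -?st ?minnn.
have -> : zip s t = zip (take i s) (take i t) ++ zip (drop i s) (drop i t).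
  by rewrite -zip_cat ?cat_take_drop // !size_takel -?st.
have : size (zip (take i s) (take i t)) = i.
  by rewrite size_zip !size_takel -?st ?minnn.
set z := zip (take i s) _ => sz; rewrite -[X in _ = rot X _]sz rot_size_cat.
by rewrite /rot zip_cat // !size_drop st.
Qed.

Lemma turns_rot i w : turns (rot i w) = rot i (turns w).
Proof. by rewrite /turns rot_rot zip_rot ?size_rot. Qed.

Lemma turns_cons l w : turns (l :: w) = rcons (steps l w) (last l w, l).
Proof.
rewrite /turns rot1_cons /steps -[RHS]/(rcons _ _).
elim: w {1 3 4}l => //= m w IH l'; congr cons; exact: IH.
Qed.

Lemma count_rot (T : Type) (a : pred T) i (s : seq T) : count a (rot i s) = count a s.
Proof. by rewrite /rot count_cat addnC -count_cat cat_take_drop. Qed.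

Lemma graph_cycle_rot i w : graph_cycle (rot i w) = graph_cycle w.
Proof.
rewrite /graph_cycle rot_cycle !map_rot !rot_uniq.
by rewrite -!size_eq0 size_rot.
Qed.

Lemma cycle_smooth_turns w : cycle smooth w ->
  all (fun lm => ~~ cw_turn lm && ~~ ccw_turn lm) (turns w).
Proof.
case: w => // l w; rewrite turns_cons.
have -> : rcons (steps l w) (last l w, l) = pairmap pair l (rcons w l).
  by rewrite -!cats1 pairmap_cat.
rewrite [cycle _ _]/=; move: (rcons w l) => v; elim: v l => //= m s IH l /andP[+ /IH ->].
rewrite andbT /smooth /follows /cw_turn /ccw_turn /=.
by case: l.2; case: m.2 => //= /negbTE ->.
Qed.

Lemma cut_cycle w : graph_cycle w ->
    clockwise_relations I w <> counterclockwise_relations I w ->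
  exists bs,
  [/\ cycle block_link bs, uniq (map block_src bs),
      uniq (flatten (map block_arrows bs)),
      all smooth_block bs /\ cycle block_cut bs
    & count snd bs != count (fun b => ~~ b.2) bs].
Proof.
move=> gw; rewrite /clockwise_relations /counterclockwise_relations.
rewrite -/cw_turn -/ccw_turn => neq.
have /cycle_breakP[i [l [v [rw ns]]]] : ~~ cycle smooth w.
  apply/negP => /cycle_smooth_turns/allP H; apply: neq.
  by rewrite !(@eq_in_count _ _ pred0) ?count_pred0 // => x /H/andP[/negbTE + /negbTE].
have {}gw : graph_cycle (l :: v) by rewrite -rw graph_cycle_rot.
have {}neq : count cw_turn (turns (l :: v)) <> count ccw_turn (turns (l :: v)).
  by rewrite -rw turns_rot !count_rot.
case/and4P: gw => _ cl us ua.
have [|b [bs [[src_b tgt_b lk ss fl] [sm ct sb sl] cnt]]] := @cut_walk l v.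
  by move: cl; rewrite [cycle _ _]/= rcons_path => /andP[].
exists (b :: bs); split.
- rewrite [cycle _ _]/= rcons_path lk /block_link src_b tgt_b.
  by move: cl; rewrite [cycle _ _]/= rcons_path => /andP[].
- exact: subseq_uniq ss us.
- by rewrite fl.
- split=> //; rewrite [cycle _ _]/= rcons_path ct andTb.
  have [t bt] : exists t, block_arrows b = l.1 :: t.
    move: sm fl => /= /andP[/andP[+ _] _].
    by case: (block_arrows b) => //= a t _ [-> _]; exists t.
  have [s bt'] : exists s, block_arrows (last b bs) = rcons s (last l v).1.
    have /andP[+ _] : smooth_block (last b bs) by apply: (allP sm); exact: mem_last.
    have := congr1 (last l.1) fl.
    rewrite -[last _ (map _ _)]/(last l.1 (map _ v)) last_map => <-.
    rewrite lastI map_rcons flatten_rcons last_cat.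
    elim/last_ind: (block_arrows _) => // s a _ _.
    by rewrite last_rcons; exists s.
  by apply: block_cut_join bt' bt _; rewrite sl sb -!surjective_pairing.
- move: neq ns cnt; rewrite turns_cons -cats1 !count_cat /= /smooth /follows.
  rewrite /cw_turn /ccw_turn /=.
  by case: l.2; case: (last l v).2 => /= neq; rewrite ?negbK => rel;
     try rewrite rel in neq *; clear -neq; lia.
Qed.

End Cutting.

Lemma split_path (Q : quiver) (p : qpath Q) s1 s2 : path_arrows p = s1 ++ s2 ->
  exists p1 p2, [/\ path_comp p1 p2 = Some p, path_src p1 = path_src p,
                    path_arrows p1 = s1 & path_arrows p2 = s2].
Proof.
move=> arr_p; have := path_valP p; rewrite -/(path_arrows p) arr_p walk_cat.
case/andP => w1 w2; pose p1 := @QPath Q (_, s1) w1; pose p2 := @QPath Q (_, s2) w2.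
exists p1, p2; split=> //.
have [r [-> src_r _ arr_r]] := @path_comp_exists Q p1 p2 erefl.
by congr Some; apply: path_eq; rewrite ?src_r ?arr_r ?arr_p.
Qed.

Lemma path_src_head (Q : quiver) (p : qpath Q) a s :
  path_arrows p = a :: s -> path_src p = src a.
Proof.
move=> arr_p; have := path_valP p; rewrite -/(path_arrows p) arr_p /=.
by case/andP => /eqP.
Qed.

Lemma path_comp_src (Q : quiver) (p q r : qpath Q) : path_comp p q = Some r ->
  [/\ path_tgt p = path_src q, path_src r = path_src p, path_tgt r = path_tgt q
    & path_arrows r = path_arrows p ++ path_arrows q].
Proof.
case: path_compP => // r' e src_r arr_r [<-].
by split=> //; exact: path_tgt_comp e src_r arr_r.
Qed.

Lemma path_comp_injr (Q : quiver) (p q q' r : qpath Q) :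
  path_comp p q = Some r -> path_comp p q' = Some r -> q = q'.
Proof.
move=> /path_comp_src[e _ _ arr_r] /path_comp_src[e' _ _].
rewrite arr_r => /eqP; rewrite eqseq_cat // eqxx => /eqP arr_q.
by apply: path_eq => //; rewrite -e -e'.
Qed.

Lemma path_comp_injl (Q : quiver) (p p' q r : qpath Q) :
  path_comp p q = Some r -> path_comp p' q = Some r -> p = p'.
Proof.
move=> /path_comp_src[_ s _ arr_r] /path_comp_src[_ s' _].
rewrite arr_r => arr_p; apply: path_eq; first by rewrite -s -s'.
have sz : size (path_arrows p) = size (path_arrows p').
  by have := congr1 size arr_p; rewrite !size_cat => /addIn.
by move/eqP: arr_p; rewrite eqseq_cat // eqxx andbT => /eqP.
Qed.

Section Coefficients.
Variables (k : fieldType) (Q : quiver).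
Local Notation kQ := (path_algebra k Q).
Implicit Types (x y : kQ) (p q r : qpath Q).

Lemma path_eltM p q : path_elt k p * path_elt k q = path_elt_mul k p q.
Proof. exact: path_mul_elt. Qed.

Lemma path_scalerAl (c : k) x y : c *: x * y = c *: (x * y).
Proof. exact/esym/path_scaleAl. Qed.

Lemma path_scalerAr (c : k) x y : x * (c *: y) = c *: (x * y).
Proof. exact/esym/path_scaleAr. Qed.

Lemma coef_path_elt_mul p q r :
  path_coef (path_elt_mul k p q) r = (path_comp p q == Some r)%:R.
Proof.
by rewrite /path_elt_mul; case: path_comp => [s|]; rewrite ?path_eltE.
Qed.

Lemma coef_eltMl q r p y : path_comp q r = Some p ->
  path_coef (path_elt k q * y) p = path_coef y r.
Proof.
move=> qr; elim/path_algebra_ind: y => [s||c x y IHx IHy].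
- rewrite path_eltM coef_path_elt_mul path_eltE; congr (_ %:R)%R; congr nat_of_bool.
  by apply/eqP/eqP => [qs|->//]; exact: path_comp_injr qs qr.
- by rewrite mulr0.
- by rewrite mulrDr path_scalerAr !path_addE !path_scaleE IHx IHy.
Qed.

Lemma coef_eltMl0 q p y : (forall r, path_comp q r <> Some p) ->
  path_coef (path_elt k q * y) p = 0.
Proof.
move=> np; elim/path_algebra_ind: y => [s||c x y IHx IHy].
- by rewrite path_eltM coef_path_elt_mul; case: eqP => // /np.
- by rewrite mulr0.
- by rewrite mulrDr path_scalerAr path_addE path_scaleE IHx IHy mulr0 addr0.
Qed.

Lemma coef_eltMr q r p x : path_comp q r = Some p ->
  path_coef (x * path_elt k r) p = path_coef x q.
Proof.
move=> qr; elim/path_algebra_ind: x => [s||c x y IHx IHy].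
- rewrite path_eltM coef_path_elt_mul path_eltE; congr (_ %:R)%R; congr nat_of_bool.
  by apply/eqP/eqP => [qs|->//]; exact: path_comp_injl qs qr.
- by rewrite mul0r.
- by rewrite mulrDl path_scalerAl !path_addE !path_scaleE IHx IHy.
Qed.

Lemma coef_eltMr0 r p x : (forall q, path_comp q r <> Some p) ->
  path_coef (x * path_elt k r) p = 0.
Proof.
move=> np; elim/path_algebra_ind: x => [s||c x y IHx IHy].
- by rewrite path_eltM coef_path_elt_mul; case: eqP => // /np.
- by rewrite mul0r.
- by rewrite mulrDl path_scalerAl path_addE path_scaleE IHx IHy mulr0 addr0.
Qed.

Lemma coef_trivialM v x y :
  path_coef (x * y) (trivial_path v) =
  path_coef x (trivial_path v) * path_coef y (trivial_path v).
Proof.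
elim/path_algebra_ind: x => [p||c x x' IH IH'].
- rewrite path_eltE; have [->|np] := eqVneq; rewrite ?mul1r ?mul0r.
    by apply: coef_eltMl; rewrite path_comp1l eqxx.
  apply: coef_eltMl0 => r /path_comp_src[_ s _ arr]; case/eqP: np; apply: path_eq => //.
  by move: arr => /=; case: (path_arrows p).
- by rewrite !mul0r.
- by rewrite mulrDl path_scalerAl !path_addE !path_scaleE IH IH' mulrDl mulrA.
Qed.

End Coefficients.

Section MonomialIdeal.
Variables (k : fieldType) (Q : quiver) (I : set (path_algebra k Q)).
Hypothesis I_ideal : two_sided_ideal I.

Definition reduced_path (p : qpath Q) := sorted (follows I true) (path_arrows p).

Lemma reduced_path_comp p q r : path_comp p q = Some r -> reduced_path r ->
  reduced_path p /\ reduced_path q.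
Proof.
by case/path_comp_src => _ _ _; rewrite /reduced_path => -> /cat_sorted2[-> ->].
Qed.

Lemma ideal_sum (J : Type) (s : seq J) (F : J -> path_algebra k Q) (P : pred J) :
  (forall j, P j -> I (F j)) -> I (\sum_(j <- s | P j) F j).
Proof. by case: I_ideal => I0 ID _ IF; elim/big_ind: _ => // x y; exact: ID. Qed.

Lemma nonreduced_path_in p : ~~ reduced_path p -> I (path_elt k p).
Proof.
case: I_ideal => _ _ IM; rewrite /reduced_path.
case arr_p: (path_arrows p) => [|a0 s] //= not_path.
have [s1 [b [s2 [es nf]]]] := path_breakP not_path.
have [s1' arr_p'] : exists s1', path_arrows p = s1' ++ last a0 s1 :: b :: s2.
  rewrite arr_p es; case/lastP: s1 {es nf} => [|s1 a]; first by exists [::].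
  by exists (a0 :: s1); rewrite last_rcons cat_rcons.
move: nf; rewrite negbK => /asboolP[q q_comp Iq].
have [p1 [r [p1r _ _ arr_r]]] := split_path arr_p'.
have [q' [p2 [q'p2 _ arr_q' _]]] := @split_path _ r [:: last a0 s1; b] s2 arr_r.
have [_ src_q _ arr_q] := path_comp_src q_comp.
have eqq : q' = q.
  by apply: path_eq; rewrite ?arr_q ?arr_q' // (path_src_head arr_q') src_q.
have -> : path_elt k p = path_elt k p1 * (path_elt k q * path_elt k p2).
  by rewrite -eqq path_eltM /path_elt_mul q'p2 path_eltM /path_elt_mul p1r.
exact: (IM _ _ (IM _ _ Iq).2).1.
Qed.

Lemma reduced_coef0 : quadratic_monomial I ->
  forall x p, I x -> reduced_path p -> path_coef x p = 0.
Proof.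
case=> S S2 eI x p Ix; move: p.
have Sx : ideal_gen [set path_elt k p | p in S]%classic x by rewrite -eI.
apply: (Sx [set y | forall p, reduced_path p -> path_coef y p = 0]%classic).
split; first split.
- by [].
- by move=> y z Jy Jz p rp; rewrite path_addE Jy // Jz // addr0.
- move=> a y Jy; split=> p rp.
    elim/path_algebra_ind: a => [q||c a b IHa IHb].
    + case: (pselect (exists r, path_comp q r = Some p)) => [[r qr]|nr].
        by rewrite (coef_eltMl _ qr) Jy //; case: (reduced_path_comp qr rp).
      by rewrite coef_eltMl0 // => r qr; apply: nr; exists r.
    + by rewrite mul0r.
    + by rewrite mulrDl path_scalerAl path_addE path_scaleE IHa IHb mulr0 addr0.
  elim/path_algebra_ind: a => [q||c a b IHa IHb].
  + case: (pselect (exists r, path_comp r q = Some p)) => [[r qr]|nr].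
      by rewrite (coef_eltMr _ qr) Jy //; case: (reduced_path_comp qr rp).
    by rewrite coef_eltMr0 // => r qr; apply: nr; exists r.
  + by rewrite mulr0.
  + by rewrite mulrDr path_scalerAr path_addE path_scaleE IHa IHb mulr0 addr0.
- move=> _ [q Sq <-] p rp; rewrite path_eltE; case: eqP => // qp; exfalso.
  have Iq : I (path_elt k q) by rewrite eI; apply: sub_gen_smallest; exists q.
  have := S2 _ Sq; move: rp; rewrite -qp /reduced_path /path_length.
  case arr_q: (path_arrows q) => [|a [|b []]] //=; rewrite andbT => /negP nr _.
  apply: nr; apply/asboolP; exists q => //.
  have := @split_path _ q [:: a] [:: b] arr_q => -[q1 [q2 [e src_q1 arr1 arr2]]].
  have <- : q1 = arrow_path a by apply: path_eq; rewrite ?(path_src_head arr1).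
  by have <- : q2 = arrow_path b by apply: path_eq; rewrite ?(path_src_head arr2).
Qed.

End MonomialIdeal.

Section BlockElement.
Variables (k : fieldType) (Q : quiver) (I : set (path_algebra k Q)).
Hypothesis I_ideal : two_sided_ideal I.
Variable bs : seq (block Q).
Hypotheses (bs_link : cycle (@block_link Q) bs)
  (bs_src : uniq (map (@block_src Q) bs))
  (bs_arrows : uniq (flatten (map (@block_arrows Q) bs)))
  (bs_smooth : all (smooth_block I) bs) (bs_cut : cycle (block_cut I) bs).

Definition block_elt : path_algebra k Q := \sum_(b <- bs) path_elt k b.1.

Lemma mem_block_arrows a (b : block Q) :
  (a \in block_arrows b) = (a \in path_arrows b.1).
Proof. by rewrite /block_arrows; case: b.2; rewrite ?mem_rev. Qed.

Lemma smooth_blockP b : b \in bs ->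
  path_arrows b.1 != [::] /\ reduced_path I b.1.
Proof.
move/(allP bs_smooth); rewrite /smooth_block /block_arrows /reduced_path.
case: b => p [] /= /andP[// pn]; rewrite rev_sorted => sp; split=> //.
by rewrite -size_eq0 -(size_rev (path_arrows p)) size_eq0.
Qed.

Lemma uniq_blocks : uniq bs. Proof. exact: map_uniq bs_src. Qed.

Lemma block_src_inj : {in bs &, injective (@block_src Q)}.
Proof.
move=> b c bbs cbs e; rewrite -[LHS](nth_index b bbs) -[RHS](nth_index b cbs).
congr (nth b bs _); apply/eqP.
rewrite -(nth_uniq (block_src b) _ _ bs_src) ?size_map ?index_mem //.
by rewrite !(nth_map b) ?index_mem // !nth_index // e.
Qed.

Lemma block_tgt_next b : b \in bs -> block_tgt b = block_src (next bs b).
Proof. by move/(next_cycle bs_link)/eqP. Qed.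

Lemma block_arrows_inj b c a : b \in bs -> c \in bs ->
  a \in path_arrows b.1 -> a \in path_arrows c.1 -> b = c.
Proof.
rewrite -!mem_block_arrows; move: bs_arrows.
elim: (bs) => //= d s IH; rewrite cat_uniq => /and3P[_ dj us].
have away x : x \in s -> a \in block_arrows d -> a \in block_arrows x -> False.
  move=> xs ad ax; case/hasP: dj; exists a => //.
  by apply/flattenP; exists (block_arrows x) => //; exact: map_f.
rewrite !inE => /orP[/eqP ->|bs'] /orP[/eqP ->|cs'] // ab ac.
- by case: (away c).
- by case: (away b).
- exact: IH.
Qed.

(* Two blocks compose only across a cut, i.e. along a relation. *)
Lemma block_comp b c r : b \in bs -> c \in bs -> path_comp b.1 c.1 = Some r ->
  ~~ reduced_path I r.
Proof.
move=> bb cb /path_comp_src[e _ _]; rewrite /reduced_path => ->.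
have nb : next bs b \in bs by rewrite mem_next.
have nc : next bs c \in bs by rewrite mem_next.
have next_inj := can_inj (prev_next uniq_blocks).
have tb := block_tgt_next bb; have tc := block_tgt_next cb.
have cut_b := next_cycle bs_cut bb; have cut_c := next_cycle bs_cut cb.
move: tb tc e cut_b cut_c; rewrite /block_tgt.
case sb: b.2; case sc: c.2 => tb tc e.
- have -> : next bs b = c.
    by apply: block_src_inj; rewrite // -tb e /block_src sc.
  by rewrite /block_cut sb sc /= /block_arrows sb sc.
- have /next_inj bc : next bs b = next bs c by apply: block_src_inj; rewrite // -tb -tc.
  by rewrite bc sc in sb.
- have bc : b = c by apply: block_src_inj; rewrite // /block_src sb sc.
  by rewrite bc sc in sb.
- have -> : next bs c = b.
    by apply: block_src_inj; rewrite // -tc -e /block_src sb.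
  move=> _; rewrite /block_cut sb sc /= /block_arrows sb sc -rev_cat.
  by rewrite rev_sorted.
Qed.

Lemma block_elt_sq : I (block_elt * block_elt).
Proof.
rewrite /block_elt mulr_suml big_seq; apply: ideal_sum => // b bb.
rewrite mulr_sumr big_seq; apply: ideal_sum => // c cb.
rewrite path_eltM /path_elt_mul; case e: path_comp => [r|]; last by case: I_ideal.
exact: (nonreduced_path_in I_ideal (block_comp bb cb e)).
Qed.

Lemma coef_block_eltMl b y : b \in bs ->
  path_coef (block_elt * y) b.1 = path_coef y (trivial_path (path_tgt b.1)).
Proof.
move=> bb; rewrite /block_elt mulr_suml path_sumE (bigD1_seq b) ?uniq_blocks //=.
rewrite (@coef_eltMl _ _ _ (trivial_path (path_tgt b.1))) ?path_comp1r ?eqxx //.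
rewrite big_seq_cond big1 ?addr0 // => c /andP[cb /eqP nbc].
apply: coef_eltMl0 => r /path_comp_src[_ _ _ arr_b].
have [+ _] := smooth_blockP cb; case arr_c: (path_arrows c.1) => [|a s] // _.
apply: nbc; apply: (@block_arrows_inj _ _ a) => //; first by rewrite arr_c mem_head.
by rewrite arr_b arr_c mem_head.
Qed.

Lemma coef_block_eltMr b x : b \in bs ->
  path_coef (x * block_elt) b.1 = path_coef x (trivial_path (path_src b.1)).
Proof.
move=> bb; rewrite /block_elt mulr_sumr path_sumE (bigD1_seq b) ?uniq_blocks //=.
rewrite (@coef_eltMr _ _ (trivial_path (path_src b.1))) ?path_comp1l ?eqxx //.
rewrite big_seq_cond big1 ?addr0 // => c /andP[cb /eqP nbc].
apply: coef_eltMr0 => r /path_comp_src[_ _ _ arr_b].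
have [+ _] := smooth_blockP cb; case arr_c: (path_arrows c.1) => [|a s] // _.
apply: nbc; apply: (@block_arrows_inj _ _ a) => //; first by rewrite arr_c mem_head.
by rewrite arr_b mem_cat arr_c mem_head orbT.
Qed.

(* Comparing the coefficients of the block paths gives c (src p) = t * c (tgt p)
   for the diagonal coefficients c of u, for every block path p. *)
Lemma block_elt_scaling (I_quad : quadratic_monomial I) u v t :
  bs != [::] -> I (u * v - 1) -> I (u * block_elt - t *: (block_elt * u)) ->
  t ^+ count snd bs = t ^+ count (fun b => ~~ b.2) bs.
Proof.
move=> bs0 Iuv Iu; pose c w := path_coef u (trivial_path w).
have step b : b \in bs -> c (path_src b.1) = t * c (path_tgt b.1).
  move=> bb; have [_ rb] := smooth_blockP bb.
  have := reduced_coef0 I_quad Iu rb.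
  rewrite -scaleNr path_addE path_scaleE coef_block_eltMr // coef_block_eltMl //.
  by rewrite mulNr => /eqP; rewrite subr_eq0 => /eqP.
have c_neq0 w : c w != 0.
  have := @reduced_coef0 _ _ _ I_quad _ (trivial_path w) Iuv isT.
  rewrite -scaleN1r path_addE path_scaleE coef_trivialM -/(c w) => /eqP.
  have -> : path_coef (1 : path_algebra k Q) (trivial_path w) = 1.
    rewrite path_sumE (bigD1 w) //= path_eltE eqxx big1 ?addr0 // => w' nw.
    rewrite path_eltE; case: eqP => // e.
    by rewrite -[w']/(path_src (trivial_path w')) e eqxx in nw.
  rewrite mulN1r subr_eq0; apply: contraTneq => ->; rewrite mul0r.
  by rewrite eq_sym oner_neq0.
have walk_scaling b s : {subset b :: s <= bs} -> path (@block_link Q) b s ->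
    c (block_src b) * t ^+ count (fun b => ~~ b.2) (b :: s)
      = c (block_tgt (last b s)) * t ^+ count snd (b :: s).
  elim: s b => [|d s IH] b sub /=.
    have := step b (sub _ (mem_head _ _)); rewrite /block_src /block_tgt.
    by case: b.2 => /= ->; rewrite !addn0 ?expr0 ?expr1 !mulr1 mulrC.
  case/andP=> /eqP link d_walk.
  have := IH d (fun x xs => sub x (@mem_behead _ (b :: d :: s) x xs)) d_walk.
  rewrite -link.
  have := step b (sub _ (mem_head _ _)); rewrite /block_src /block_tgt /=.
  case: b.2 => /= ->; rewrite !exprD ?expr0 ?expr1 ?mul1r => IHd.
    by rewrite -mulrA IHd mulrCA.
  by rewrite mulrCA mulrA IHd.
case: (bs) bs0 bs_link walk_scaling => // b s _.
rewrite [cycle _ _]/= rcons_path => /andP[link /eqP close] /(_ b s (fun _ => id) link).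
by rewrite close => /(mulfI (c_neq0 _)).
Qed.

End BlockElement.

Section LeftMultiplication.
Variables (k : fieldType) (L : falgType k).
Implicit Types x u v : L.

Definition left_mul x (y : (L^c)^o) : (L^c)^o := x * (y : L).

Lemma left_mul_linear x : linear (left_mul x).
Proof.
move=> c y z; rewrite /left_mul -[LHS]/(x * ((y : L) * (c : L) + (z : L))).
by rewrite mulrDr mulrA.
Qed.

HB.instance Definition _ x :=
  GRing.isLinear.Build L^c (L^c)^o (L^c)^o *:%R (left_mul x) (left_mul_linear x).

Lemma regular_fg : finitely_generated (L^c)^o.
Proof.
exists 1%N, (fun=> 1) => y; exists (fun=> y); rewrite big_ord1.
exact/esym/(@mulr1 L^c).
Qed.

Lemma regular_projective : projective (L^c)^o.
Proof.
move=> M N g h g_surj; have [m gm] := g_surj (h 1).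
pose l (y : (L^c)^o) : M := (y : L^c) *: m.
have l_lin : linear l by move=> c y z; rewrite /l scalerDl scalerA.
pose lM := GRing.isLinear.Build L^c (L^c)^o M *:%R l l_lin.
pose lL : {linear (L^c)^o -> M} := HB.pack l lM.
exists lL => y; rewrite -[lL y]/((y : L^c) *: m) linearZ /= gm -linearZ /=.
by congr (h _); exact: (@mulr1 L^c).
Qed.

Variables (x : L) (x_sq : x * x = 0).

Lemma left_mul_sq y : left_mul x (left_mul x y) = 0.
Proof. by rewrite /left_mul mulrA x_sq mul0r. Qed.

Definition left_mul_diff : diff_module L^c :=
  @DiffModule L^c (L^c)^o (left_mul x) regular_fg left_mul_sq.

(* A grading X of the differential module makes t act by t ^ i in degree i. This
   automorphism of the module is left multiplication by a unit u, and it scales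
   the differential, which has degree 1, by t. *)
Lemma gradable_left_mul t : t != 0 -> gradable left_mul_diff ->
  exists u v, u * v = 1 /\ u * x = t *: (x * u).
Proof.
move=> t0 [X [f [f_morph [g fK gK]]]].
pose sc (s : k) (i : int) : L^c := ((s ^ i)%:A : L).
have sc_comm s i (c : L^c) : c * sc s i = sc s i * c.
  rewrite -[LHS]/(((s ^ i)%:A : L) * (c : L)) -[RHS]/((c : L) * ((s ^ i)%:A : L)).
  by rewrite mulr_algl mulr_algr.
have tw_supp s (y : dsum X) :
    exists r : seq int, forall i, i \notin r -> sc s i *: y i = 0.
  by have [r yr] := dsum_supp y; exists r => i /yr ->; rewrite scaler0.
pose tw s (y : dsum X) : dsum X := DSum (asboolT (tw_supp s y)).
have twZ s (c : L^c) y : tw s (c *: y) = c *: tw s y.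
  by apply: dsumP => i; rewrite /= !scalerA sc_comm.
have twV s y : s != 0 -> tw s (tw s^-1 y) = y.
  move=> s0; apply: dsumP => i; rewrite /= scalerA.
  suff -> : sc s i * sc s^-1 i = 1 by rewrite scale1r.
  rewrite -[LHS]/(((s^-1 ^ i)%:A : L) * ((s ^ i)%:A : L)) mulr_algl scalerA.
  by rewrite -expfzMl mulVf // exp1rz scale1r.
have f_mul (a y : L) : f (a * y) = (y : L^c) *: f (a : (L^c)^o) by rewrite -linearZ.
have rep s : {u : L | forall y : L, f (u * y) = tw s (f (y : (L^c)^o))}.
  exists (g (tw s (f (1 : L)))) => y; rewrite f_mul gK -twZ -f_mul.
  by rewrite mul1r.
have [u uP] := rep t; have [v vP] := rep t^-1.
have f_inj : injective f := can_inj fK.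
exists u, v; split; apply: f_inj.
  by rewrite uP -[v]mulr1 vP twV.
have fd y : f (x * (y : L)) = total_d (f y) by exact: f_morph.
have tw_d y : tw t (total_d y) = ((t%:A : L) : L^c) *: total_d (tw t y).
  apply: dsumP => i; rewrite /= [in RHS]linearZ /= scalerA; congr (_ *: _).
  rewrite -[RHS]/(((t ^ (i - 1))%:A : L) * (t%:A : L)) mulr_algl scalerA.
  by rewrite -{3}(expr1z t) -expfzDr // subrK.
have -> : t *: (x * u) = (x * u) * (t%:A : L) by rewrite mulr_algr.
rewrite uP -[x]mulr1 fd tw_d f_mul; congr (_ *: _).
by rewrite mulr1 fd -[u in RHS]mulr1 uP.
Qed.

End LeftMultiplication.

Lemma closed_field_expr_neq (k : closedFieldType) (m n : nat) : m != n ->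
  exists2 t : k, t != 0 & t ^+ m != t ^+ n.
Proof.
move=> mn; pose p : {poly k} := 'X^(m.+1) - 'X^(n.+1) + 1.
have p_size : size p != 1%N.
  have pm : p`_m.+1 = 1.
    by rewrite /p coefD coefB !coefXn coef1 eqxx eqSS (negbTE mn) subr0 addr0.
  rewrite gtn_eqF //; apply: leq_trans (_ : m.+1 < size p)%N => //.
  by rewrite ltnNge; apply/negP => /(nth_default 0) /eqP; rewrite pm oner_eq0.
have /closed_rootP[t] := p_size.
rewrite /root /p !hornerE => /eqP tE.
exists t; apply: contra_eq_neq tE => eq_t.
  by rewrite !exprS eq_t !mul0r subrr add0r oner_neq0.
by rewrite !exprS eq_t subrr add0r oner_neq0.
Qed.

Theorem proposition4 (k : closedFieldType) (L : falgType k) (Q : quiver)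
    (I : set (path_algebra k Q))
    (L_basic : basic_ring L^c)
    (L_fgd : finite_global_dimension L^c)
    (I_admissible : admissible I)
    (I_quadratic : quadratic_monomial I)
    (L_kQI : quotient_algebra I L)
    (not_clock : ~ clock_condition I) :
  exists D : diff_module L^c, relatively_projective D /\ ~ gradable D.
Proof.
have [w gw neq] : exists2 w : seq (letter Q), graph_cycle w
    & clockwise_relations I w <> counterclockwise_relations I w.
  by apply: contra_notP not_clock => no w gw; apply: contra_notP no => neq; exists w.
have [bs [bs_link bs_src bs_arrows [bs_smooth bs_cut] bs_count]] := cut_cycle gw neq.
have I_ideal := I_admissible.1.
have [pi [piZ pi_surj pi_ker]] := L_kQI.
pose x := pi (block_elt k bs).
have x_sq : x * x = 0.
  by rewrite -rmorphM; apply/pi_ker; exact: block_elt_sq.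
exists (left_mul_diff x_sq); split; first exact: regular_projective.
have [t t0 tn] := closed_field_expr_neq k bs_count.
move=> /(gradable_left_mul t0)[u [v [uv ux]]].
have [u' u'E] := pi_surj u; have [v' v'E] := pi_surj v.
case/eqP: tn.
apply: (block_elt_scaling bs_link bs_src bs_arrows bs_smooth I_quadratic
  (u := u') (v := v')).
- by case: (bs) bs_count.
- by apply/pi_ker; rewrite rmorphB rmorphM rmorph1 u'E v'E uv subrr.
- by apply/pi_ker; rewrite rmorphB /= piZ !rmorphM /= u'E ux subrr.
Qed.
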